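(* Let $k\ge2$ and let $\beta^{(2k)}$ be a sequence such that $\beta_{X^2Y^2}\neq\beta_{XYXY}$. If $\mathcal M_k$ is of rank at most 3, then $\beta^{(2k)}$ does not admit a representing measure.
   Context: Words are elements of the free monoid on noncommuting letters $X,Y$; $|w|$ is the length of $w$, $w^*$ its reverse, and $v,w$ are cyclically equivalent if $v$ is a cyclic permutation of $w$. A sequence $\beta^{(2k)}=(\beta_w)_{|w|\le2k}$ is a family of real numbers indexed by words of length at most $2k$ with $\beta_v=\beta_w$ for cyclically equivalent $v,w$ and $\beta_w=\beta_{w^*}$. Its moment matrix is $\mathcal M_k=(\beta_{U^*V})_{|U|\le k,|V|\le k}$, with rows and columns indexed by words of length at most $k$. A representing measure for $\beta^{(2k)}$ consists of finitely many pairs $(A_i,B_i)$ of real symmetric $t_i\times t_i$ matrices and numbers $\lambda_i>0$ with $\sum_i\lambda_i=1$ and $\beta_w=\sum_i\lambda_i\mathrm{Tr}(w(A_i,B_i))$ for all $|w|\le2k$, where $\mathrm{Tr}(A)=\frac1t\mathrm{tr}(A)$ for $A\in\mathbb R^{t\times t}$. *)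

(* Defs.v *)
From HB Require Import structures.
From mathcomp Require Import all_boot all_order all_algebra.
From mathcomp Require Import reals.
Set Implicit Arguments.
Unset Strict Implicit.
Unset Printing Implicit Defensive.
Import Order.TTheory GRing.Theory Num.Theory.
Local Open Scope ring_scope.

Inductive letter := X | Y.

Definition bool_of_letter (l : letter) : bool := if l is Y then true else false.
Definition letter_of_bool (b : bool) : letter := if b then Y else X.

Lemma bool_of_letterK : cancel bool_of_letter letter_of_bool.
Proof. by case. Qed.

HB.instance Definition _ := Finite.copy letter (can_type bool_of_letterK).

Notation word := (seq letter).

Definition cyclically_equivalent (v w : word) : Prop := exists n, v = rot n w.

(* A sequence beta^(2k) is encoded as a function on all words; its values on
   words of length greater than 2k are arbitrary and never used. *)
Definition tracial_sequence (R : realType) (k : nat) (beta : word -> R) : Prop :=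
  (forall v w : word, (size v <= 2 * k)%N -> (size w <= 2 * k)%N ->
     cyclically_equivalent v w -> beta v = beta w) /\
  (forall w : word, (size w <= 2 * k)%N -> beta w = beta (rev w)).

(* The finite type [k.-bseq letter] consists of the words of length at most k. *)
Definition moment_matrix (R : realType) (k : nat) (beta : word -> R) :
    'M[R]_(#|{: k.-bseq letter}|) :=
  \matrix_(i, j) beta (rev (enum_val i : k.-bseq letter)
                       ++ (enum_val j : k.-bseq letter)).

Definition eval_word (R : realType) (t : nat) (A B : 'M[R]_t) (w : word) :
    'M[R]_t :=
  \big[mulmx/1%:M]_(l <- w) (if l is X then A else B).

Definition normalized_trace (R : realType) (t : nat) (A : 'M[R]_t) : R :=
  t%:R^-1 * \tr A.

Definition representing_measure (R : realType) (k : nat) (beta : word -> R)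
    (n : nat) (t : 'I_n -> nat) (A B : forall i : 'I_n, 'M[R]_(t i))
    (lambda : 'I_n -> R) : Prop :=
  [/\ forall i, (0 < t i)%N,
      forall i, (A i)^T = A i /\ (B i)^T = B i,
      forall i, 0 < lambda i,
      \sum_(i < n) lambda i = 1 &
      forall w : word, (size w <= 2 * k)%N ->
        beta w =
        \sum_(i < n) lambda i * normalized_trace (eval_word (A i) (B i) w)].

Definition admits_representing_measure (R : realType) (k : nat)
    (beta : word -> R) : Prop :=
  exists (n : nat) (t : 'I_n -> nat) (A B : forall i : 'I_n, 'M[R]_(t i))
    (lambda : 'I_n -> R), representing_measure k beta A B lambda.

(* Main.v *)
Require Import Defs.
From HB Require Import structures.
From mathcomp Require Import all_boot all_order all_algebra.
From mathcomp Require Import reals.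
Set Implicit Arguments.
Unset Strict Implicit.
Unset Printing Implicit Defensive.
Import Order.TTheory GRing.Theory Num.Theory.
Local Open Scope ring_scope.

(** A representing measure makes the moment matrix a Gram matrix of evaluated
    words, so its rank is at least the number of words whose evaluations at a
    single atom are linearly independent. As the two moments differ, some atom
    (A, B) does not commute. Then 1, A, B, AB are linearly independent: if AB
    were a combination of 1, A, B it would be symmetric, hence equal to BA, and
    a relation between 1, A, B would express one of A, B through the other.
    So the rank is at least 4. *)

Lemma mxrank_mxsub (F : fieldType) (m n p q : nat) (f : 'I_p -> 'I_m)
    (g : 'I_q -> 'I_n) (M : 'M[F]_(m, n)) :
  (\rank (mxsub f g M) <= \rank M)%N.
Proof.
rewrite -[M in mxsub _ _ M]mulmx1 mxsub_mul (leq_trans (mxrankM_maxl _ _)) //.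
by rewrite -[M in rowsub _ M]mul1mx -mul_rowsub_mx mxrankM_maxr.
Qed.

Lemma mxtrace_trmul (R : realType) (m n : nat) (Q : 'M[R]_(m, n)) :
  \tr (Q^T *m Q) = \sum_j \sum_i Q i j ^+ 2.
Proof.
by apply: eq_bigr => j _; rewrite mxE; apply: eq_bigr => i _; rewrite mxE expr2.
Qed.

Lemma mxtrace_trmul_ge0 (R : realType) (m n : nat) (Q : 'M[R]_(m, n)) :
  0 <= \tr (Q^T *m Q).
Proof.
by rewrite mxtrace_trmul; apply: sumr_ge0 => j _; apply: sumr_ge0 => i _;
  exact: sqr_ge0.
Qed.

Lemma mxtrace_trmul_eq0 (R : realType) (m n : nat) (Q : 'M[R]_(m, n)) :
  \tr (Q^T *m Q) = 0 -> Q = 0.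
Proof.
rewrite mxtrace_trmul => /eqP; rewrite psumr_eq0; last first.
  by move=> j _; apply: sumr_ge0 => i _; exact: sqr_ge0.
move=> /allP Q0; apply/matrixP => i j; rewrite mxE; apply/eqP.
have := Q0 j (mem_index_enum j).
rewrite /= psumr_eq0; last by move=> ? _; exact: sqr_ge0.
by move=> /allP/(_ i (mem_index_enum i)); rewrite /= sqrf_eq0.
Qed.

Section EvalWord.
Variables (R : realType) (t : nat) (A B : 'M[R]_t).

Lemma eval_word_nil : eval_word A B [::] = 1%:M.
Proof. by rewrite /eval_word big_nil. Qed.

Lemma eval_word_cons l w :
  eval_word A B (l :: w) = (if l is X then A else B) *m eval_word A B w.
Proof. by rewrite /eval_word big_cons. Qed.

Lemma eval_word_cat v w :
  eval_word A B (v ++ w) = eval_word A B v *m eval_word A B w.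
Proof.
elim: v => [|l v IHv] /=; first by rewrite eval_word_nil mul1mx.
by rewrite !eval_word_cons IHv mulmxA.
Qed.

Lemma eval_word_rev w : A^T = A -> B^T = B ->
  eval_word A B (rev w) = (eval_word A B w)^T.
Proof.
move=> symA symB; elim: w => [|l w IHw]; first by rewrite eval_word_nil trmx1.
rewrite rev_cons -cats1 eval_word_cat !eval_word_cons eval_word_nil mulmx1.
by rewrite trmx_mul IHw; case: l; rewrite ?symA ?symB.
Qed.

End EvalWord.

(** Let [u] be in the left kernel of the submatrix indexed by the words [w i], and let $Q_s=\sum_i
    u_i\,w_i(A_s,B_s)$. The quadratic form of that submatrix at [u] is
    $\sum_s\lambda_s\mathrm{Tr}(Q_s^TQ_s)$, a vanishing sum of nonnegative terms. So $Q_l=0$ already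
    at the one atom [l], and freeness there forces $u=0$. *)
Lemma rank_moment_matrix_ge (R : realType) (k : nat) (beta : word -> R)
    (n : nat) (t : 'I_n -> nat) (A B : forall l : 'I_n, 'M[R]_(t l))
    (lambda : 'I_n -> R) (m : nat) (w : 'I_m -> k.-bseq letter) (l : 'I_n) :
  representing_measure k beta A B lambda ->
  (forall u : 'I_m -> R,
     \sum_i u i *: eval_word (A l) (B l) (w i) = 0 -> forall i, u i = 0) ->
  (m <= \rank (moment_matrix k beta))%N.
Proof.
move=> [t_gt0 symAB lam_gt0 _ betaE] free_w.
pose f i := enum_rank (w i).
suff /eqP <- : row_free (mxsub f f (moment_matrix k beta)).
  exact: mxrank_mxsub.
rewrite -kermx_eq0; apply/eqP/row_matrixP => r.
rewrite row0; set u := row r _.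
have /matrixP uM0 : u *m mxsub f f (moment_matrix k beta) = 0.
  by apply/sub_kermxP; exact: row_sub.
pose Q s := \sum_i u 0 i *: eval_word (A s) (B s) (w i).
have gramE : \sum_s lambda s * normalized_trace ((Q s)^T *m Q s) = 0.
  (* Both sides expand into one triple sum, since for symmetric matrices a reversed word evaluates
     to the transpose. *)
  transitivity (\sum_j u 0 j * \sum_i u 0 i * beta (rev (w i) ++ w j)).
    transitivity (\sum_j \sum_i \sum_s u 0 j * (u 0 i *
        (lambda s * normalized_trace
           (eval_word (A s) (B s) (rev (w i) ++ w j))))); last first.
      apply: eq_bigr => j _; rewrite mulr_sumr; apply: eq_bigr => i _.
      rewrite betaE ?mulr_sumr //.
      by rewrite size_cat size_rev mul2n -addnn leq_add ?size_bseq.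
    rewrite [RHS](eq_bigr _ (fun j _ => exchange_big _ _ _ _ _ _)) /=.
    rewrite exchange_big /=; apply: eq_bigr => s _.
    have [symA symB] := symAB s.
    have -> : (Q s)^T *m Q s = \sum_j \sum_i (u 0 j * u 0 i) *:
        eval_word (A s) (B s) (rev (w i) ++ w j).
      rewrite mulmx_sumr; apply: eq_bigr => j _.
      rewrite [(Q s)^T]raddf_sum mulmx_suml; apply: eq_bigr => i _ /=.
      by rewrite eval_word_cat eval_word_rev // -scalemxAr [(_ *: _)^T]linearZ
        -scalemxAl scalerA.
    rewrite /normalized_trace raddf_sum !mulr_sumr; apply: eq_bigr => j _.
    rewrite raddf_sum !mulr_sumr; apply: eq_bigr => i _ /=.
    by rewrite mxtraceZ (mulrCA _^-1) (mulrCA (lambda s)) -mulrA.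
  (* Each inner sum is an entry of [u] times the submatrix, hence zero. *)
  apply: big1 => j _; rewrite [X in _ * X](_ : _ = 0) ?mulr0 //.
  transitivity ((u *m mxsub f f (moment_matrix k beta)) 0 j).
    rewrite [RHS]mxE; apply: eq_bigr => i _; congr (_ * _).
    by rewrite !mxE !enum_rankK.
  by rewrite uM0 mxE.
have term_ge0 s : 0 <= lambda s * normalized_trace ((Q s)^T *m Q s).
  by rewrite mulr_ge0 ?(ltW (lam_gt0 s)) // mulr_ge0 ?invr_ge0 ?ler0n
    ?mxtrace_trmul_ge0.
have Ql0 : Q l = 0.
  apply: mxtrace_trmul_eq0; apply/eqP.
  move/eqP: gramE; rewrite psumr_eq0 // => /allP/(_ l (mem_index_enum l)) /=.
  (* The positive size [t l] matters here: at size zero the factor [t%:R^-1] would vanish. *)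
  rewrite !mulf_eq0 invr_eq0 pnatr_eq0 (gt_eqF (lam_gt0 l)).
  by rewrite eqn0Ngt t_gt0.
by apply/rowP => i; rewrite [RHS]mxE; exact: (free_w _ Ql0).
Qed.

Lemma noncommuting_free (R : realType) (t : nat) (A B : 'M[R]_t)
    (a b c d : R) :
  A^T = A -> B^T = B -> A *m B != B *m A ->
  a *: 1%:M + b *: A + c *: B + d *: (A *m B) = 0 ->
  [/\ a = 0, b = 0, c = 0 & d = 0].
Proof.
move=> symA symB nAB rel.
have d0 : d = 0.
  apply/eqP; apply: contraNT nAB => d_neq0; apply/eqP.
  apply: (scalerI d_neq0).
  (* Transposition fixes the first three terms and turns $AB$ into $BA$; comparing the two relations
     leaves $d\,AB=d\,BA$. *)
  have := congr1 trmx rel.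
  rewrite !linearD !linearZ /= trmx_mul trmx1 symA symB trmx0 -{1}rel.
  by move/addrI.
move: rel; rewrite d0 scale0r addr0 => rel.
have c0 : c = 0.
  apply/eqP; apply: contraNT nAB => c_neq0; apply/eqP.
  apply: (scalerI c_neq0).
  (* Now $cB=-(a+bA)$, which commutes with $A$. *)
  move/eqP: rel; rewrite addrC addr_eq0 => /eqP rel.
  rewrite scalemxAr scalemxAl rel mulmxN mulNmx mulmxDr mulmxDl.
  by rewrite -!scalemxAr -!scalemxAl mulmx1 mul1mx.
move: rel; rewrite c0 scale0r addr0 => rel.
have b0 : b = 0.
  apply/eqP; apply: contraNT nAB => b_neq0; apply/eqP.
  apply: (scalerI b_neq0).
  move/eqP: rel; rewrite addrC addr_eq0 => /eqP rel.
  rewrite scalemxAl scalemxAr rel mulmxN mulNmx.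
  by rewrite -!scalemxAr -!scalemxAl mulmx1 mul1mx.
move: rel; rewrite b0 scale0r addr0 => rel; split=> //.
apply/eqP; apply: contraNT nAB => a_neq0; apply/eqP.
(* If $1=0$, all products vanish and $A$, $B$ commute. *)
have I0 : 1%:M = 0 :> 'M[R]_t by apply: (scalerI a_neq0); rewrite rel scaler0.
by rewrite -[A]mulmx1 I0 mulmx0 mul0mx mulmx0.
Qed.

Theorem corollary2p4 (R : realType) (k : nat) (beta : word -> R)
    (hk : (2 <= k)%N)
    (hbeta : tracial_sequence k beta)
    (hne : beta [:: X; X; Y; Y] <> beta [:: X; Y; X; Y])
    (hrank : (\rank (moment_matrix k beta) <= 3)%N) :
  ~ admits_representing_measure k beta.
Proof.
move=> [n [t [A [B [lambda meas]]]]].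
have [l nAB] : exists l, A l *m B l != B l *m A l.
  apply/existsP; apply: contra_notT hne; rewrite negb_exists => /forallP AB.
  case: meas => _ _ _ _ betaE.
  have hk4 : (4 <= 2 * k)%N by rewrite (leq_mul2l 2 2).
  (* $X^2Y^2$ and $XYXY$ differ only by swapping the two middle letters, so commuting atoms give
     equal traces. *)
  rewrite !betaE //; apply: eq_bigr => l _; do 2!congr (_ * _).
  have /eqP ABl := negbNE (AB l).
  rewrite !eval_word_cons eval_word_nil mulmx1; congr (\tr (_ *m _)).
  by rewrite !mulmxA ABl.
have [symA symB] : (A l)^T = A l /\ (B l)^T = B l by case: meas.
have szw (v : word) : (size v <= 2)%N -> (size v <= k)%N.
  by move=> /leq_trans; apply.
(* The words $1,X,Y,XY$ have length at most $2\le k$, so they index rows of the moment matrix. *)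
pose w : 'I_4 -> k.-bseq letter := tnth [tuple Bseq (szw [::] isT);
  Bseq (szw [:: X] isT); Bseq (szw [:: Y] isT); Bseq (szw [:: X; Y] isT)].
suff : (4 <= \rank (moment_matrix k beta))%N by rewrite leqNgt ltnS hrank.
apply: (rank_moment_matrix_ge (w := w) meas) => u.
rewrite !big_ord_recl big_ord0 addr0 /w !(tnth_nth (Bseq (szw [::] isT))) /=.
rewrite !eval_word_cons eval_word_nil !mulmx1 !addrA.
move=> /(noncommuting_free symA symB nAB) [u0 u1 u2 u3] i.
by case: i => [[|[|[|[|?]]]] // ?]; [rewrite -[RHS]u0 | rewrite -[RHS]u1
  | rewrite -[RHS]u2 | rewrite -[RHS]u3]; congr u; exact: val_inj.
Qed.
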